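(* Let $A_i\in M_{n_i}(\mathbb{C})$, $i=1,\ldots,p$, be normal matrices with spectra $\sigma(A_i)=\{\lambda^i_k\}_{k=1}^{n_i}$. Let $S_i$ be complex $n_i\times m$ matrices, $i=1,\ldots,p$, such that $\sum_{i=1}^p S_i^*S_i=I_m$ is the identity operator on $\mathbb{C}^m$. Put $$B=\sum_{i=1}^p S_i^*A_iS_i,\qquad \sigma(B)=(\mu_1,\ldots,\mu_m),$$ $n=n_1+\ldots+n_p$, and $$(\lambda_1,\ldots,\lambda_n)=(\lambda^1_1,\ldots,\lambda^1_{n_1},\lambda^2_1,\ldots,\lambda^2_{n_2},\ldots,\lambda^p_{n_p}).$$ Then $$C_k(\{\mu_j-\alpha\}_{j=1}^{m})\prec_{uds} C_k(\{\lambda_j-\alpha\}_{j=1}^{n})$$ for all $k$ with $1\le k\le m$ and all $\alpha\in\mathbb{C}$.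
   Context: $\sigma(\cdot)$ is the list of eigenvalues counted with algebraic multiplicity. For a vector $\{z_j\}_{j=1}^N\in\mathbb{C}^N$ and $1\le k\le N$, $C_k(\{z_j\}_{1}^N):=\{z_{i_1}\cdots z_{i_k}\}_{1\le i_1<\ldots<i_k\le N}\in\mathbb{C}^{\binom{N}{k}}$. A real matrix $S\in M_N(\mathbb{R})$ is unitary-stochastic if there is a unitary $U=(u_{ij})\in M_N(\mathbb{C})$ with $s_{ij}=|u_{ij}|^2$ for all $i,j$. For finite sequences of complex numbers $x=\{x_j\}_{j=1}^l$ and $y=\{y_j\}_{j=1}^N$ with $l\le N$, $x\prec_{uds}y$ means: there exist complex numbers $x_{l+1},\ldots,x_N$ and a unitary-stochastic matrix $S\in M_N(\mathbb{R})$ such that $(x_1,\ldots,x_N)^T=S(y_1,\ldots,y_N)^T$. *)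

(* Defs.v *)
From mathcomp Require Import all_boot all_order all_algebra.
From mathcomp Require Import spectral complex reals.

Set Implicit Arguments.
Unset Strict Implicit.
Unset Printing Implicit Defensive.

Import GRing.Theory Num.Theory.
Local Open Scope ring_scope.
Local Open Scope complex_scope.

(* The complex field is R[i] with R : realType; finite families of complex
   numbers are sequences of type seq R[i], indexed from 0. *)

(* s lists the eigenvalues of A, in some order, each repeated according to its
   multiplicity as a root of the characteristic polynomial. *)
Definition is_spectrum (R : realType) (n : nat) (A : 'M[R[i]]_n)
    (s : seq R[i]) : Prop :=
  char_poly A = \prod_(z <- s) ('X - z%:P).

(* C_k(z): a strictly increasing k-tuple t of indices encodes
   i_1 < ... < i_k. *)
Definition kproducts (R : realType) (k : nat) (z : seq R[i]) : seq R[i] :=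
  [seq \prod_(j < k) z`_(tnth t j)
     | t : k.-tuple 'I_(size z)
         <- enum [set t : k.-tuple 'I_(size z) | sorted ltn (map val t)]].

Definition unitary_stochastic (R : realType) (N : nat) (S : 'M[R]_N) : Prop :=
  exists U : 'M[R[i]]_N,
    U \is unitarymx /\ (forall i j, (S i j)%:C = `|U i j| ^+ 2).

Definition col_of_seq (R : realType) (N : nat) (s : seq R[i]) : 'cV[R[i]]_N :=
  \col_(i < N) s`_i.

(* w holds the free completion x_{l+1}, ..., x_N of x. *)
Definition uds (R : realType) (x y : seq R[i]) : Prop :=
  (size x <= size y)%N /\
  exists (w : seq R[i]) (S : 'M[R]_(size y)),
    [/\ size (x ++ w) = size y,
        unitary_stochastic S
      & col_of_seq (size y) (x ++ w)
        = map_mx (real_complex R) S *m col_of_seq (size y) y].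

(* Main.v *)
(* Stacking the S_i and diagonalizing the A_i writes B = Z_0 D Z_0^*, where D
   is diagonal with entries lambda and Z_0 has orthonormal rows; by Schur, B
   may be replaced by a triangular matrix T = Z D Z^* with diagonal mu, and
   subtracting alpha from T and D preserves this identity. By Cauchy-Binet,
   the principal k-minors of T - alpha, which are the products in C_k(mu -
   alpha), are the averages of the products in C_k(lambda - alpha) with
   weights the squared moduli of the k-minors of Z. These minors again form a
   matrix with orthonormal rows, which is completed to a unitary matrix. *)

Require Import Defs.
From mathcomp Require Import all_boot all_order all_algebra.
From mathcomp Require Import spectral complex reals.
From mathcomp Require Import perm.

Set Implicit Arguments.
Unset Strict Implicit.
Unset Printing Implicit Defensive.

Import GRing.Theory Num.Theory.
Local Open Scope ring_scope.
Local Open Scope sesquilinear_scope.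

(** * Increasing tuples as [k]-subsets, and the Cauchy-Binet formula *)

Notation increasing k N := [set t : k.-tuple 'I_N | sorted ltn (map val t)].

Lemma increasing_uniq k N (t : k.-tuple 'I_N) :
  t \in increasing k N -> uniq t.
Proof.
rewrite inE ltn_sorted_uniq_leq map_inj_uniq; last exact: val_inj.
by case/andP.
Qed.

Lemma increasing_inj k N (t : k.-tuple 'I_N) :
  t \in increasing k N -> injective (tnth t).
Proof. by move=> /increasing_uniq /tuple_uniqP. Qed.

Lemma increasing_eq k N (s t : k.-tuple 'I_N) :
  s \in increasing k N -> t \in increasing k N -> s =i t -> s = t.
Proof.
rewrite !inE => s_inc t_inc st; apply/val_inj/(inj_map val_inj).
apply: (irr_sorted_eq ltn_trans ltnn) => // a.
by apply/mapP/mapP => -[x x_in ->]; exists x; rewrite // ?st // -st.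
Qed.

(** An inclusion between two sets of the same size [k] is an equality, and a set has only one
    increasing listing. *)
Lemma increasing_neq k N (s t : k.-tuple 'I_N) :
  s \in increasing k N -> t \in increasing k N -> s != t ->
  exists i, tnth s i \notin t.
Proof.
move=> s_inc t_inc; move=> /eqP s_neq.
apply/existsP; apply: contra_notT s_neq; rewrite negb_exists => /forallP s_t.
apply: increasing_eq => //.
have sub: {subset s <= t} by move=> _ /tnthP[i ->]; rewrite -[_ \in _]negbK.
apply: (uniq_min_size _ sub _).2; first exact: increasing_uniq.
by rewrite !size_tuple.
Qed.

(** Sorting the values of [f] gives [t], and [s] records the order in which [f] takes them. With the
    next lemma, injective maps correspond bijectively to pairs of an increasing tuple and a
    permutation. *)
Lemma injective_increasing_perm k N (f : {ffun 'I_k -> 'I_N}) :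
  injective f ->
  exists2 t : k.-tuple 'I_N, t \in increasing k N
    & exists s : 'S_k, f = [ffun i => tnth t (s i)].
Proof.
move=> f_inj; pose t := [tuple f i | i < k].
pose t' : k.-tuple 'I_N := sort_tuple (relpre val leq) t.
exists t'.
  rewrite inE ltn_sorted_uniq_leq map_inj_uniq; last exact: val_inj.
  rewrite sort_uniq sorted_map sort_sorted ?andbT.
    by apply/tuple_uniqP => i j; rewrite !tnth_mktuple => /f_inj.
  by move=> a b; exact: leq_total.
have /tuple_permP[s ts] : perm_eq t t' by rewrite perm_sym perm_sort.
exists s; apply/ffunP => i; rewrite ffunE.
have /val_inj tE : val t = val [tuple tnth t' (s i) | i < k] by [].
by rewrite -[LHS](tnth_mktuple f) -/t tE tnth_mktuple.
Qed.

Lemma increasing_perm_inj k N :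
  {in [pred x : k.-tuple 'I_N * 'S_k | x.1 \in increasing k N] &,
   injective (fun x : k.-tuple 'I_N * 'S_k => [ffun i => tnth x.1 (x.2 i)])}.
Proof.
move=> [t s] [t' s']; rewrite ![_ \in [pred _ | _]]/= => t_inc t'_inc /= /ffunP E.
have tt' : t = t'.
  apply: increasing_eq => // x.
  apply/tnthP/tnthP => -[i ->].
    by exists (s' (s^-1%g i)); have := E (s^-1%g i); rewrite !ffunE permKV.
  by exists (s (s'^-1%g i)); have := E (s'^-1%g i); rewrite !ffunE permKV.
rewrite -tt' in E *; congr (_, _); apply/permP => i.
by have := E i; rewrite !ffunE => /(increasing_inj t_inc).
Qed.

(** Expanding each entry of the product turns the determinant into a sum over all maps [f], the rows
    of [B] being chosen by [f]. A non-injective [f] repeats a row and contributes 0; the injective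
    ones are grouped by their image [t]. *)
Lemma Cauchy_Binet (R : comNzRingType) k N (A : 'M[R]_(k, N)) (B : 'M_(N, k)) :
  \det (A *m B) = \sum_(t in increasing k N)
    \det (colsub (tnth t) A) * \det (rowsub (tnth t) B).
Proof.
pose G (f : {ffun 'I_k -> 'I_N}) := (\prod_i A i (f i)) * \det (rowsub f B).
transitivity (\sum_f G f).
  transitivity (\sum_(f : {ffun 'I_k -> 'I_N}) \sum_(s : 'S_k)
      (-1) ^+ s * \prod_i (A i (f i) * B (f i) (s i))).
    rewrite exchange_big; apply: eq_bigr => /= s _; rewrite -big_distrr /=.
    congr (_ * _); rewrite -(bigA_distr_bigA (fun i j => A i j * B j (s i))) /=.
    by apply: eq_bigr => i _; rewrite mxE.
  apply: eq_bigr => f _; rewrite /G big_distrr /=; apply: eq_bigr => s _.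
  rewrite big_split /= mulrCA; congr (_ * (_ * _)).
  by apply: eq_bigr => i _; rewrite mxE.
rewrite (bigID (fun f : {ffun 'I_k -> 'I_N} => injectiveb f)) /=.
rewrite [X in _ + X]big1 => [|f /injectivePn[i1 [i2 Di Ei]]]; last first.
  by rewrite /G (determinant_alternate Di) ?mulr0 // => j; rewrite !mxE Ei.
pose h (x : k.-tuple 'I_N * 'S_k) := [ffun i => tnth x.1 (x.2 i)].
pose D := [pred x : k.-tuple 'I_N * 'S_k | x.1 \in increasing k N].
rewrite addr0 (eq_bigl (mem (h @: D))) => [|f]; last first.
  apply/injectiveP/imsetP => [/injective_increasing_perm[t t_inc [s ->]]|].
    by exists (t, s).
  move=> [[t s] t_inc -> i j]; rewrite !ffunE.
  by move=> /(increasing_inj t_inc) /perm_inj.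
rewrite big_imset /=; last exact: increasing_perm_inj.
under eq_bigl => x do rewrite inE -[_ \in _]andbT.
rewrite -(pair_big (fun t => t \in increasing k N) xpredT
  (fun t s => G (h (t, s)))) /=.
apply: eq_bigr => t _; rewrite [\det (colsub _ _)]/determinant big_distrl /=.
apply: eq_bigr => s _; rewrite /G.
(* Reordering the rows of the minor of [B] yields the sign of [s], which is the sign needed in the
   Leibniz formula for the minor of [A]. *)
have -> : rowsub (h (t, s)) B = perm_mx s *m rowsub (tnth t) B.
  by rewrite -row_permE; apply/matrixP => i j; rewrite !mxE ffunE.
rewrite det_mulmx det_perm mulrCA mulrA; congr (_ * _ * _).
by apply: eq_bigr => i _; rewrite !mxE ffunE.
Qed.

Lemma det_mxsub1 (R : comNzRingType) k m (s s' : k.-tuple 'I_m) :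
  s \in increasing k m -> s' \in increasing k m ->
  \det (mxsub (tnth s) (tnth s') 1%:M) = (s == s')%:R :> R.
Proof.
move=> s_inc s'_inc; case: eqVneq => [<-|/(increasing_neq s_inc s'_inc)[i s_i]].
  rewrite -[RHS](det1 R k); congr (\det _); apply/matrixP => i j.
  by rewrite !mxE (inj_eq (increasing_inj s_inc)).
(* Row [i] vanishes: its index [tnth s i] is not among the columns [s']. *)
rewrite (expand_det_row _ i) big1 // => j _; rewrite !mxE.
by case: eqP s_i => [->|_ _]; rewrite ?mem_tnth ?mul0r.
Qed.

(* A permutation [s] with [r (s i) <= r i] for all [i] is trivial, as both sides
   have the same sum: only the identity contributes to the Leibniz formula. *)
Lemma det_ranked (R : comNzRingType) k (r : 'I_k -> nat) (M : 'M[R]_k) :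
  injective r -> (forall i j, (r i < r j)%N -> M i j = 0) ->
  \det M = \prod_i M i i.
Proof.
move=> r_inj M0; rewrite /determinant (bigD1 (1%g : 'S_k)) //=.
rewrite [X in _ + X]big1 => [|s s_neq1].
  by rewrite odd_perm1 expr0 mul1r addr0; apply: eq_bigr => i _; rewrite perm1.
suff [i ri] : exists i, (r i < r (s i))%N.
  by rewrite (bigD1 i) //= M0 // mul0r mulr0.
apply/existsP; apply: contraNT s_neq1; rewrite negb_exists => /forallP r_le.
have le i : (r (s i) <= r i)%N by rewrite leqNgt.
have : (\sum_i r (s i) == \sum_i r i)%N by rewrite [X in _ == X](reindex_perm s).
rewrite (leqif_sum (fun i _ => leqif_eq (le i))) => /forallP r_eq.
by apply/eqP/permP => i; rewrite perm1; apply/r_inj/eqP; exact: (implyP (r_eq i)).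
Qed.

(** * Compound matrices: the [k]-minors of [Z] *)

Section Compound.
Variables (C : numClosedFieldType) (k m N : nat).
Implicit Types (Z : 'M[C]_(m, N)) (s t : k.-tuple 'I_m).

(** By Cauchy-Binet the compound of a product is the product of the compounds, and the compound of a
    diagonal matrix is diagonal. *)
Lemma det_mxsub_sandwich Z (d : 'rV[C]_N) s s' :
  \det (mxsub (tnth s) (tnth s') (Z *m diag_mx d *m Z^t*)) =
  \sum_(t in increasing k N) \det (mxsub (tnth s) (tnth t) Z)
     * (\prod_j d 0 (tnth t j)) * (\det (mxsub (tnth s') (tnth t) Z))^*.
Proof.
rewrite -mulmxA mxsub_mul Cauchy_Binet; apply: eq_bigr => t _.
have -> : rowsub (tnth t) (colsub (tnth s') (diag_mx d *m Z^t*)) =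
   diag_mx (\row_j d 0 (tnth t j)) *m (mxsub (tnth s') (tnth t) Z)^t*.
  apply/matrixP => i j; by rewrite !mul_diag_mx !mxE.
rewrite det_mulmx det_diag det_map_mx det_tr mulrA.
congr (_ * _ * _); first by congr (\det _); apply/matrixP=> i j; rewrite !mxE.
by apply: eq_bigr => j _; rewrite mxE.
Qed.

Lemma compound_unitary Z s s' : Z \is unitarymx ->
  s \in increasing k m -> s' \in increasing k m ->
  \sum_(t in increasing k N)
    \det (mxsub (tnth s) (tnth t) Z) * (\det (mxsub (tnth s') (tnth t) Z))^* =
  (s == s')%:R.
Proof.
move=> /unitarymxP ZZ s_inc s'_inc; rewrite -det_mxsub1 // -ZZ.
rewrite -[X in X *m _]mulmx1 -diag_const_mx det_mxsub_sandwich.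
by apply: eq_bigr => t _; rewrite big1 ?mulr1 // => j _; rewrite mxE.
Qed.

(** The submatrix of [T] on the indices [s] is still triangular, for the ranking [r \o tnth s], so
    its determinant is the product of its diagonal. *)
Lemma compound_diag Z (d : 'rV[C]_N) (T := Z *m diag_mx d *m Z^t*) r s :
  injective r -> (forall i j : 'I_m, (r i < r j)%N -> T i j = 0) ->
  s \in increasing k m ->
  \prod_j T (tnth s j) (tnth s j) = \sum_(t in increasing k N)
     `|\det (mxsub (tnth s) (tnth t) Z)| ^+ 2 * \prod_j d 0 (tnth t j).
Proof.
move=> r_inj T0 s_inc.
transitivity (\det (mxsub (tnth s) (tnth s) T)).
  rewrite (@det_ranked _ _ (r \o tnth s)).
  - by apply: eq_bigr => j _; rewrite [RHS]mxE.
  - exact: (inj_comp r_inj (increasing_inj s_inc)).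
  - by move=> i j ij; rewrite [LHS]mxE T0.
rewrite det_mxsub_sandwich; apply: eq_bigr => t _.
by rewrite normCK mulrAC.
Qed.
End Compound.

(** * From orthonormal rows to [uds] *)

Lemma unitary_completion (C : numClosedFieldType) a b (X : 'M[C]_(a, b)) :
  X \is unitarymx ->
  (a <= b)%N /\ exists2 U : 'M[C]_b, U \is unitarymx &
    forall (i : 'I_a) (i' : 'I_b) j, i = i' :> nat -> U i' j = X i j.
Proof.
(* The rows of [Y] are an orthonormal basis of the orthogonal complement of the row space of [X]. *)
move=> X_unitary; pose K := kermx (X^t*); pose Y := schmidt (row_base K).
have XY : Y *m X^t* = 0.
  apply/sub_kermxP; rewrite eqmx_schmidt_free ?row_base_free //.
  by rewrite eq_row_base.
have le_ab : (a <= b)%N by rewrite -{1}(mxrank_unitary X_unitary) rank_leq_col.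
have eK : (a + \rank K = b)%N.
  by rewrite mxrank_ker mxrank_map mxrank_tr mxrank_unitary // subnKC.
split=> //; exists (castmx (eK, erefl b) (col_mx X Y)) => [|i i' j ii'].
  have: col_mx X Y \is unitarymx.
    apply/unitarymxP; rewrite tr_col_mx map_row_mx mul_col_row XY.
    rewrite !(unitarymxP _) ?schmidt_unitarymx ?rank_leq_col //.
    have -> : X *m Y^t* = 0.
      rewrite -[LHS]trmxCK trmx_mul map_mxM trmxCK XY.
      by rewrite !(trmx0, map_mx0).
    by rewrite -scalar_mx_block.
  by move: (col_mx X Y); move: (a + _)%N eK => c; case: _ /.
rewrite castmxE cast_ord_id.
have -> : cast_ord (esym eK) i' = lshift _ i by apply: val_inj; rewrite /= ii'.
by rewrite col_mxEu.
Qed.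

Lemma uds_unitary_rows (R : realType) (x y : seq R[i])
    (X : 'M[R[i]]_(size x, size y)) :
  X \is unitarymx ->
  (forall i : 'I_(size x), x`_i = \sum_j `|X i j| ^+ 2 * y`_j) -> uds x y.
Proof.
move=> /unitary_completion[le_xy [U U_unitary UX]] xE; split=> //.
(* [v] is the full image of [y] under the squared moduli of [U]: it starts with [x], and its tail is
   the free completion. *)
pose v := [seq \sum_j `|U i j| ^+ 2 * y`_j | i <- enum 'I_(size y)].
have vE (i : 'I_(size y)) : v`_i = \sum_j `|U i j| ^+ 2 * y`_j.
  by rewrite (nth_map i) ?size_enum_ord // nth_ord_enum.
have sv : size v = size y by rewrite size_map size_enum_ord.
have xv : take (size x) v = x.
  apply: (@eq_from_nth _ 0) => [|i]; first by rewrite size_takel ?sv.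
  rewrite size_takel ?sv // => ix; rewrite nth_take //.
  pose i' := Ordinal ix; pose i'' := widen_ord le_xy i'.
  rewrite -[i in LHS]/(val i'') vE -[i in RHS]/(val i') xE.
  by apply: eq_bigr => j _; rewrite (UX i').
exists (drop (size x) v), (\matrix_(i, j) complex.Re (`|U i j| ^+ 2)).
have SE i j : real_complex R (complex.Re (`|U i j| ^+ 2)) = `|U i j| ^+ 2.
  by apply: RRe_real; rewrite realX // normr_real.
rewrite -{1 3}xv cat_take_drop; split=> //.
  by exists U; split=> // i j; rewrite mxE SE.
apply/colP => i; rewrite !mxE vE; apply: eq_bigr => j _.
by rewrite !mxE SE.
Qed.

(** This form lets arbitrary finite sets index the rows and columns, as needed for minors, which are
    indexed by increasing tuples. *)
Lemma uds_enum (R : realType) (I J : finType) (P : {set I}) (Q : {set J})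
    (f : I -> R[i]) (g : J -> R[i]) (M : I -> J -> R[i]) :
  {in P &, forall i i', \sum_(j in Q) M i j * (M i' j)^* = (i == i')%:R} ->
  {in P, forall i, f i = \sum_(j in Q) `|M i j| ^+ 2 * g j} ->
  uds [seq f i | i <- enum P] [seq g j | j <- enum Q].
Proof.
move=> M_unitary fE.
have sP : #|P| = size [seq f i | i <- enum P] by rewrite size_map cardE.
have sQ : #|Q| = size [seq g j | j <- enum Q] by rewrite size_map cardE.
pose X := \matrix_(i < #|P|, j < #|Q|) M (enum_val i) (enum_val j).
apply: (@uds_unitary_rows _ _ _ (castmx (sP, sQ) X)) => [|i].
  have: X \is unitarymx.
    apply/unitarymxP/matrixP => i i'; rewrite !mxE.
    rewrite -(inj_eq enum_val_inj) -M_unitary ?enum_valP // [RHS]big_enum_val.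
    by apply: eq_bigr => j _; rewrite !mxE.
  by move: X; case: _ / sP; case: _ / sQ.
pose i' := cast_ord (esym sP) i.
have -> : [seq f i | i <- enum P]`_i = f (enum_val i').
  by rewrite (nth_map (enum_default i')) // -cardE (ltn_ord i').
rewrite fE ?enum_valP // big_enum_val.
rewrite (reindex (cast_ord (esym sQ))) /=; last first.
  by apply: onW_bij; exists (cast_ord sQ); [exact: cast_ordKV|exact: cast_ordK].
apply: eq_bigr => j _; rewrite castmxE mxE; congr (_ * _).
pose j' := cast_ord (esym sQ) j.
by rewrite (nth_map (enum_default j')) // -cardE (ltn_ord j').
Qed.

(** Replacing [size z] by a variable lets the same tuples select rows or columns of a matrix. *)
Lemma kproductsE (R : realType) k m (z : seq R[i]) (ez : size z = m) :
  kproducts k z = [seq \prod_(j < k) z`_(tnth t j)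
    | t : k.-tuple 'I_m <- enum (increasing k m)].
Proof. by case: _ / ez. Qed.

Lemma uds_kproducts_diag (R : realType) k m N (Z : 'M[R[i]]_(m, N))
    (x y : seq R[i]) (T := Z *m diag_mx (\row_j y`_j) *m Z^t*)
    (r : 'I_m -> nat) :
  size x = m -> size y = N -> Z \is unitarymx -> injective r ->
  (forall i j, (r i < r j)%N -> T i j = 0) -> (forall i, T i i = x`_i) ->
  uds (kproducts k x) (kproducts k y).
Proof.
move=> sx sy Z_unitary r_inj T0 Tx; rewrite (kproductsE k sx) (kproductsE k sy).
apply: (@uds_enum _ _ _ _ _ _ _ (fun s t => \det (mxsub (tnth s) (tnth t) Z))).
  by move=> s s' s_inc s'_inc; exact: compound_unitary.
move=> s s_inc; under eq_bigr => j _ do rewrite -Tx.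
rewrite (compound_diag r_inj T0 s_inc); apply: eq_bigr => t _.
by congr (_ * _); apply: eq_bigr => j _; rewrite mxE.
Qed.

(** * Schur and spectral decompositions with a prescribed order of eigenvalues *)

Lemma char_poly_unitary (C : numClosedFieldType) n (P A : 'M[C]_n) :
  P \is unitarymx -> char_poly (P *m A *m P^t*) = char_poly A.
Proof.
move=> /unitarymxP PP.
have cPP : map_mx polyC P *m map_mx polyC (P^t*) = 1%:M.
  by rewrite -map_mxM PP map_mx1.
have cA : char_poly_mx (P *m A *m P^t*)
    = map_mx polyC P *m char_poly_mx A *m map_mx polyC (P^t*).
  rewrite /char_poly_mx !map_mxM mulmxBr mulmxBl; congr (_ - _).
  by rewrite mul_mx_scalar -scalemxAl cPP scalemx1.
by rewrite /char_poly cA !det_mulmx mulrAC -det_mulmx cPP det1 mul1r.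
Qed.

Lemma row_perm_unitary (C : numClosedFieldType) m n s (P : 'M[C]_(m, n)) :
  P \is unitarymx -> row_perm s P \is unitarymx.
Proof.
move=> /unitarymxP/matrixP PP; apply/unitarymxP/matrixP => i j.
rewrite mxE; transitivity ((P *m P^t*) (s i) (s j)); last first.
  by rewrite PP !mxE (inj_eq perm_inj).
by rewrite mxE; apply: eq_bigr => l _; rewrite !mxE.
Qed.

(* Prescribing the order of the diagonal costs the triangular shape: only a
   ranking [r] of the indices for which the matrix is triangular survives. *)
Lemma Schur_spectrum (C : numClosedFieldType) n (A : 'M[C]_n) (s : n.-tuple C) :
  (0 < n)%N -> char_poly A = \prod_(z <- s) ('X - z%:P) ->
  exists2 Q : 'M_n, Q \is unitarymx & exists2 r : 'I_n -> nat, injective r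
    & (forall i j, (r i < r j)%N -> (Q *m A *m Q^t*) i j = 0)
      /\ (forall i, (Q *m A *m Q^t*) i i = tnth s i).
Proof.
move=> n_gt0 As; have [P P_unitary] := Schur A n_gt0.
rewrite /similar_to conjymx //; set T := P *m A *m P^t* => T_trig.
pose t := [tuple T i i | i < n].
have /tuple_permP[p sp] : perm_eq s t.
  apply: prod_XsubC_eq; rewrite -As -(char_poly_unitary _ P_unitary) -/T.
  rewrite char_poly_trig // big_tuple.
  by apply: eq_bigr => i _; rewrite tnth_mktuple.
have QE i j : (row_perm p P *m A *m (row_perm p P)^t*) i j = T (p i) (p j).
  rewrite mxE /T [RHS]mxE; apply: eq_bigr => l _.
  by rewrite !mxE; congr (_ * _); apply: eq_bigr => l' _; rewrite !mxE.
exists (row_perm p P); first exact: row_perm_unitary.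
exists (fun i => p i : nat); first by move=> i j /val_inj /perm_inj.
split=> [i j ij|i]; rewrite QE; first by move/is_trig_mxP: T_trig; apply.
have /val_inj -> : val s = val [tuple tnth t (p i) | i < n] by [].
by rewrite !tnth_mktuple.
Qed.

(** The spectral theorem gives the eigenvalues in some order; permuting the rows of the unitary
    matrix brings them into the order of [s]. *)
Lemma normal_spectrum (C : numClosedFieldType) n (A : 'M[C]_n) (s : n.-tuple C) :
  A \is normalmx -> char_poly A = \prod_(z <- s) ('X - z%:P) ->
  exists2 W : 'M_n, W \is unitarymx
    & A = W^t* *m diag_mx (\row_i tnth s i) *m W.
Proof.
move=> /orthomx_spectralP; set P := spectralmx A; set d := spectral_diag A.
have P_unitary : P \is unitarymx by exact: spectral_unitarymx.
rewrite invmx_unitary // => AE As; pose t := [tuple d 0 i | i < n].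
have /tuple_permP[p sp] : perm_eq s t.
  apply: prod_XsubC_eq; rewrite -As AE.
  rewrite -[X in _ *m X]trmxCK char_poly_unitary ?trmxC_unitary //.
  rewrite char_poly_trig ?diag_mx_is_trig // big_tuple.
  by apply: eq_bigr => i _; rewrite tnth_mktuple mxE eqxx.
exists (row_perm p P); first exact: row_perm_unitary.
rewrite [LHS]AE; apply/matrixP => i j; rewrite -!mulmxA !mul_diag_mx !mxE.
rewrite (reindex_perm p); apply: eq_bigr => l _; rewrite !mxE.
have /val_inj -> : val s = val [tuple tnth t (p i) | i < n] by [].
by rewrite !tnth_mktuple.
Qed.

(** * Stacking the blocks *)

Lemma mulmx_diag_tagged (C : numClosedFieldType) (p m : nat) (n : 'I_p -> nat)
    (V : forall i, 'M[C]_(m, n i)) (f : forall i, 'I_(n i) -> C)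
    (* [Z] is the row of blocks [V i]; pairs of a block and a position in it index its columns,
       which avoids casts between sums of sizes. *)
    (Z := \matrix_(c < m, a < #|{: {i : 'I_p & 'I_(n i)}}|)
      V (tag (enum_val a)) c (tagged (enum_val a))) :
  Z *m diag_mx (\row_a f _ (tagged (enum_val a))) *m Z^t* =
  \sum_i V i *m diag_mx (\row_j f i j) *m (V i)^t*.
Proof.
apply/matrixP => c c'; rewrite summxE mxE.
pose F i j := V i c j * f i j * (V i c' j)^*.
transitivity (\sum_i \sum_j F i j); last first.
  apply: eq_bigr => i _; rewrite mxE; apply: eq_bigr => j _.
  by rewrite mul_mx_diag !mxE.
rewrite sig_big_dep [RHS]big_enum_val /=; apply: eq_bigr => a _.
by rewrite mul_mx_diag !mxE.
Qed.

(** The pairs are enumerated block by block, so the concatenated spectra follow the column order of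
    the stacked matrix. *)
Lemma flatten_tagged (T : Type) (p : nat) (n : 'I_p -> nat)
    (s : forall i, (n i).-tuple T) :
  flatten [seq (s i : seq T) | i <- enum 'I_p] =
  [seq tnth (s (tag x)) (tagged x) | x <- enum {: {i : 'I_p & 'I_(n i)}}].
Proof.
rewrite [enum {: {i : 'I_p & 'I_(n i)}}]enumT unlock /= /tag_enum map_flatten.
rewrite -[in RHS]map_comp -enumT; congr flatten; apply: eq_map => i /=.
by rewrite -[in RHS]map_comp -enumT -[LHS]map_tnth_enum.
Qed.

Unset Implicit Arguments.

Theorem corollary3p11 (R : realType) (p m : nat) (n : 'I_p -> nat)
    (A : forall i : 'I_p, 'M[R[i]]_(n i))
    (lambda : forall i : 'I_p, (n i).-tuple R[i])
    (S : forall i : 'I_p, 'M[R[i]]_(n i, m))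
    (mu : m.-tuple R[i])
    (A_normal : forall i : 'I_p, A i \is normalmx)
    (A_spectrum : forall i : 'I_p, is_spectrum (A i) (lambda i))
    (S_sum : \sum_(i < p) ((S i) ^t* *m S i) = 1%:M)
    (B_spectrum : is_spectrum (\sum_(i < p) ((S i) ^t* *m A i *m S i)) mu)
    (k : nat) (hk : (1 <= k <= m)%N) (alpha : R[i]) :
  uds (kproducts k [seq z - alpha | z <- mu])
      (kproducts k
         [seq z - alpha
            | z <- flatten [seq (lambda i : seq R[i]) | i <- enum 'I_p]]).
Proof.
have m_gt0 : (0 < m)%N by case/andP: hk => /leq_trans k_gt0 /k_gt0.
have [Q Q_unitary [r r_inj [T0 Tmu]]] := Schur_spectrum m_gt0 B_spectrum.
have [W W_unitary AE] :=
  fin_all_exists2 (fun i => normal_spectrum (A_normal i) (A_spectrum i)).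
(* Writing [A i] as [W^* D W] turns the [i]-th summand of [B] into [V D V^*]. *)
pose V i := (S i)^t* *m (W i)^t*.
have VE i : (V i)^t* = W i *m S i by rewrite trmx_mul map_mxM !trmxCK.
pose N := #|{: {i : 'I_p & 'I_(n i)}}|.
pose Z0 : 'M_(m, N) :=
  \matrix_(c, a) V (tag (enum_val a)) c (tagged (enum_val a)).
pose l : 'rV_N :=
  \row_a tnth (lambda (tag (enum_val a))) (tagged (enum_val a)).
(* This is the stacking identity with every eigenvalue replaced by 1, which turns the sum for [B]
   into [S_sum]. *)
have Z0_unitary : Z0 \is unitarymx.
  apply/unitarymxP; rewrite -S_sum -[X in X *m _]mulmx1 -diag_const_mx.
  have const1 q : const_mx 1 = \row_(a < q) 1 :> 'rV[R[i]]_q.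
    by apply/rowP => a; rewrite !mxE.
  rewrite const1; apply: etrans (mulmx_diag_tagged V (fun _ _ => 1)) _.
  apply: eq_bigr => i _.
  by rewrite -const1 diag_const_mx mulmx1 VE /V !mulmxA mulmxKtV.
have Z0_B : Z0 *m diag_mx l *m Z0^t* = \sum_i (S i)^t* *m A i *m S i.
  apply: etrans (mulmx_diag_tagged V (fun i => tnth (lambda i))) _.
  by apply: eq_bigr => i _; rewrite VE AE /V !mulmxA.
have Z_unitary : Q *m Z0 \is unitarymx by exact: mul_unitarymx.
rewrite flatten_tagged -map_comp; set y := (X in uds _ (kproducts _ X)).
have dE : diag_mx (\row_(a < N) y`_a) = diag_mx l - alpha%:M.
  rewrite -diag_const_mx -linearB; congr diag_mx; apply/rowP => a; rewrite !mxE.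
  by rewrite /y (nth_map (enum_default a)) // -cardE (ltn_ord a).
(* The orthonormal rows of [Q *m Z0] carry the scalar matrix [alpha%:M] of size [N] to that of size
   [m]. *)
have TE : Q *m Z0 *m diag_mx (\row_(a < N) y`_a) *m (Q *m Z0)^t* =
    Q *m (\sum_i (S i)^t* *m A i *m S i) *m Q^t* - alpha%:M.
  rewrite dE mulmxBr mulmxBl mul_mx_scalar -scalemxAl (unitarymxP _) //.
  by rewrite scalemx1 -Z0_B trmx_mul map_mxM !mulmxA.
apply: (@uds_kproducts_diag _ k m N (Q *m Z0) _ y r _ _ Z_unitary r_inj).
- by rewrite size_map size_tuple.
- by rewrite size_map -cardE.
- move=> i j ij; rewrite TE mxE T0 // !mxE.
  by case: eqP ij => [->|_ _]; rewrite ?ltnn ?subr0.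
- move=> i; rewrite TE mxE Tmu !mxE eqxx (nth_map 0) ?size_tuple //.
  by rewrite (tnth_nth 0).
Qed.
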